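(* Let $\pi\colon X\to Y$ be a surjective continuous map between two compact metrizable spaces, and let $\widetilde{\pi}\colon\mathcal{M}(X)\to \mathcal{M}(Y)$ be the map induced by $\pi$. Then $\pi$ is open if and only if $\widetilde{\pi}$ is open.
   Context: $\mathcal{M}(X)$ is the space of Borel probability measures on $X$ with the weak*-topology, i.e. the smallest topology making $\mu\mapsto\int_X g\,d\mu$ continuous for every continuous $g\colon X\to\mathbb{R}$. The induced map is $(\widetilde{\pi}\mu)(B)=\mu(\pi^{-1}B)$ for every Borel $B\subseteq Y$. A map between topological spaces is open if images of open sets are open. *)

(* Defs.v *)
From HB Require Import structures.
From mathcomp Require Import all_boot all_order all_algebra.
From mathcomp Require Import all_classical all_reals all_analysis.

Set Implicit Arguments.
Unset Strict Implicit.
Unset Printing Implicit Defensive.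

Import Order.TTheory GRing.Theory Num.Theory.
Import numFieldNormedType.Exports.

Local Open Scope classical_set_scope.
Local Open Scope ring_scope.

Definition metrizable (R : realType) (X : topologicalType) : Prop :=
  exists d : X -> X -> R,
    [/\ forall x, d x x = 0,
        forall x y, d x y = 0 -> x = y,
        forall x y, d x y = d y x,
        forall x y z, d x z <= d x y + d y z &
        forall (x : X) (A : set X),
          nbhs x A <-> exists2 e : R, 0 < e & [set y | d x y < e] `<=` A].

Definition open_map (X Y : topologicalType) (f : X -> Y) : Prop :=
  forall U : set X, open U -> open (f @` U).

Notation borel X := (g_sigma_algebraType (@open X)).

(* A library measure is a function on all subsets, and its values on
   non-measurable sets carry no meaning. They are fixed to 0 here, so that two
   elements are equal exactly when they agree on Borel sets (borel_prob_eqP). *)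
Record borel_prob (R : realType) (X : ptopologicalType) := BorelProb {
  bp_measure :> probability (borel X) R ;
  bp_out : forall A : set (borel X), ~ measurable A -> bp_measure A = 0%E }.

HB.instance Definition _ (R : realType) (X : ptopologicalType) :=
  gen_eqMixin (borel_prob R X).
HB.instance Definition _ (R : realType) (X : ptopologicalType) :=
  gen_choiceMixin (borel_prob R X).

Lemma borel_prob_eqP (R : realType) (X : ptopologicalType)
    (mu nu : borel_prob R X) :
  mu = nu <-> forall B : set (borel X), measurable B -> mu B = nu B.
Proof.
split=> [-> //|munu].
have {}munu : (mu : set (borel X) -> \bar R) = nu.
  apply/funext => B; have [mB|mB] := pselect (measurable B); first exact: munu.
  by rewrite !bp_out.
case: mu nu munu => [[m mc] mo] [[n nc] no] /= mn; subst n.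
have mnc : mc = nc.
  move: mc nc {mo no}.
  move=> [[a1 a2] [a3] [a4] [a5] [a6] [a7] [a8]].
  move=> [[b1 b2] [b3] [b4] [b5] [b6] [b7] [b8]].
  rewrite (Prop_irrelevance a1 b1) (Prop_irrelevance a2 b2).
  rewrite (Prop_irrelevance a3 b3) (Prop_irrelevance a4 b4).
  rewrite (Prop_irrelevance a5 b5) (Prop_irrelevance a6 b6).
  by rewrite (Prop_irrelevance a7 b7) (Prop_irrelevance a8 b8).
by subst nc; rewrite (Prop_irrelevance mo no).
Qed.

(* The weak* topology: the supremum over all continuous g : X -> R of the
   initial topologies of the maps mu |-> \int[mu]_x g x. *)
Section weakstar.
Variables (R : realType) (X : ptopologicalType).

Definition bp_integral (g : continuousType X R) (mu : borel_prob R X) : R :=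
  \int[mu]_(x in [set: borel X]) g x.

Definition weakstar : topologicalType :=
  @sup_topology (borel_prob R X) (continuousType X R)
    (fun g => Topological.class (initial_topology (bp_integral g))).

HB.instance Definition _ := Topological.copy (borel_prob R X) weakstar.

End weakstar.

Section induced.
Variables (R : realType) (X Y : ptopologicalType) (f : X -> Y).
Hypothesis cf : continuous f.

Lemma continuous_borel : measurable_fun [set: borel X] (f : borel X -> borel Y).
Proof.
apply: (@measurability _ _ (borel X) (borel Y) _ _ (@open Y)) => // _ [B oB <-].
by rewrite setTI; apply: sub_sigma_algebra; move/continuousP: cf; apply.
Qed.

Let measurable_preim (B : set (borel Y)) :
  measurable B -> measurable (f @^-1` B : set (borel X)).
Proof. by move=> mB; rewrite -[X in measurable X]setTI; exact: continuous_borel. Qed.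

Variable mu : borel_prob R X.

Definition induced_fun (B : set (borel Y)) : \bar R :=
  if `[< measurable B >] then mu (f @^-1` B) else 0%E.

Let induced0 : induced_fun set0 = 0%E.
Proof. by rewrite /induced_fun; case: ifP => //; rewrite preimage_set0 measure0. Qed.

Let induced_ge0 B : (0 <= induced_fun B)%E.
Proof. by rewrite /induced_fun; case: ifP. Qed.

Let inducedE B : measurable B -> induced_fun B = mu (f @^-1` B).
Proof. by move=> mB; rewrite /induced_fun asboolT. Qed.

Let induced_sigma_additive : semi_sigma_additive induced_fun.
Proof.
move=> F mF tF mUF; rewrite inducedE// preimage_bigcup.
under eq_fun do under eq_bigr do rewrite inducedE//.
apply: measure_semi_sigma_additive.
- by move=> n; exact: measurable_preim.
- apply/trivIsetP => /= i j _ _ ij; rewrite -preimage_setI.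
  by move/trivIsetP : tF => /(_ _ _ _ _ ij) ->//; rewrite preimage_set0.
- by rewrite -preimage_bigcup; exact: measurable_preim.
Qed.

HB.instance Definition _ := isMeasure.Build _ _ _ induced_fun
  induced0 induced_ge0 induced_sigma_additive.

Let induced_setT : induced_fun [set: borel Y] = 1%E.
Proof. by rewrite inducedE// preimage_setT probability_setT. Qed.

HB.instance Definition _ :=
  Measure_isProbability.Build _ _ _ induced_fun induced_setT.

Let induced_out (B : set (borel Y)) : ~ measurable B -> induced_fun B = 0%E.
Proof. by move=> mB; rewrite /induced_fun asboolF. Qed.

Definition induced_prob : borel_prob R Y := BorelProb induced_out.

Lemma induced_probE (B : set (borel Y)) :
  measurable B -> induced_prob B = mu (f @^-1` B).
Proof. exact: inducedE. Qed.

End induced.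

(* Main.v *)
Require Import Defs.
From HB Require Import structures.
From mathcomp Require Import finmap.
From mathcomp Require Import all_boot all_order all_algebra.
From mathcomp Require Import all_classical all_reals all_analysis.
From mathcomp Require Import measurable_realfun giry ring lra.

(** If the induced map is open, test it on Dirac measures: a measure close to the
    Dirac mass at [x] and projecting to the Dirac mass at [y] lives on the fibre
    of [y] and still charges a prescribed neighbourhood of [x].

    Conversely let [pi] be open and fix [mu], with image [nu], and finitely many
    test functions [F i]. Take a partition of unity [phi n] of [X] subordinate to
    small sets [{dev n < e}] on which every [F i] is nearly constant. Since the
    images [pi {dev n < e}] are open, there is a continuous partition of unity
    [a n] of [Y] with [a n = 0] off [pi {dev n < e}] and
    [\int a n dnu = \int phi n dmu]. It is obtained from the products [chi_S] of
    cut-off functions [t n] ([n] in [S]) and [1 - t n] ([n] not in [S]) by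
    redistributing each [chi_S] with the weights
    [\int phi n * (chi_S \o pi) dmu / \int chi_S dnu].
    With Borel sections [s n] of [pi] taking values in [{dev n <= e}] over its
    image, every [nu'] lifts to [mu' = \sum_n (s n)_* (a n nu')], and
    [\int F i dmu'] is within [e] of [\int A_i dnu'] for a continuous [A_i] on [Y]
    independent of [nu'], while [\int F i dmu] is within [e] of [\int A_i dnu]. *)
Set Implicit Arguments.
Unset Strict Implicit.
Unset Printing Implicit Defensive.

Import Order.TTheory GRing.Theory Num.Theory.
Import numFieldNormedType.Exports.

Local Open Scope classical_set_scope.
Local Open Scope ring_scope.

(** * Basic neighbourhoods in the weak* topology *)

Section weakstar_topology.
Variables (R : realType) (X : ptopologicalType).
Implicit Types mu : borel_prob R X.

Lemma bp_integral_continuous (g : continuousType X R) :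
  continuous (bp_integral g : borel_prob R X -> R).
Proof.
move=> mu.
have /cvg_sup/(_ g) h : nbhs (mu : borel_prob R X) --> (mu : weakstar R X).
  exact: cvg_id.
move=> A nA; apply: (h (bp_integral g @^-1` A)).
exact: (@initial_continuous _ _ (bp_integral g) mu A nA).
Qed.

(** The sets [W] with this property form a filter. It converges to [mu] in each initial topology,
    hence in their supremum, and so contains every neighbourhood of [mu]. *)
Lemma weakstar_nbhs (mu : borel_prob R X) (W : set (borel_prob R X)) :
  nbhs mu W ->
  exists (I : finType) (F : I -> continuousType X R) (e : R), 0 < e /\
    forall mu', (forall i, `|bp_integral (F i) mu' - bp_integral (F i) mu| < e) ->
      W mu'.
Proof.
pose Phi : set_system (borel_prob R X) := fun W =>
  exists (I : finType) (F : I -> continuousType X R) (e : R), 0 < e /\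
    forall mu', (forall i, `|bp_integral (F i) mu' - bp_integral (F i) mu| < e) ->
      W mu'.
have PhiF : Filter Phi.
  split.
  - by exists void, (of_void _), 1.
  - move=> P Q [I [F [e [e0 FP]]]] [J [G [e' [e'0 GQ]]]].
    exists (I + J)%type, (fun k => match k with inl i => F i | inr j => G j end).
    exists (Num.min e e'); split; first by rewrite lt_min e0.
    move=> mu' h; split.
      by apply: FP => i; have := h (inl i); rewrite lt_min => /andP[].
    by apply: GQ => j; have := h (inr j); rewrite lt_min => /andP[].
  - move=> P Q PQ [I [F [e [e0 FP]]]]; exists I, F, e; split=> // mu' h.
    exact/PQ/FP.
suff : Phi --> (mu : weakstar R X) by apply.
apply/cvg_sup => g U.
have /= -> := @nbhsE (initial_topology (bp_integral g)) mu.
case=> B [[C oC <-] /= Cmu] /filterS; apply.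
have /nbhs_ballP[e /= e0 eC] : nbhs (bp_integral g mu) C by exact: open_nbhs_nbhs.
exists unit, (fun=> g), e; split=> // mu' /(_ tt) h.
by apply: eC; rewrite /ball /= distrC.
Qed.

End weakstar_topology.

(** * Metric consequences: separation, continuity of the distance, bump functions *)

Section metrizable_topology.
Variables (R : realType) (X : topologicalType).

Lemma metrizable_hausdorff : metrizable R X -> hausdorff_space X.
Proof.
move=> [d [d0 d_eq dC dtri dnb]] x y clxy; apply: d_eq.
apply: contrapT => /eqP dn0.
have dge0 u v : 0 <= d u v.
  by have := dtri u v u; rewrite d0 (dC v u); lra.
have dxy : 0 < d x y / 2 by rewrite divr_gt0 // lt0r dn0 dge0.
have [z [/= xz yz]] : [set z | d x z < d x y / 2] `&` [set z | d y z < d x y / 2] !=set0.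
  by apply: clxy; apply/dnb; exists (d x y / 2).
by have := dtri x z y; rewrite (dC z y); lra.
Qed.

End metrizable_topology.

Lemma metric_continuous (R : realType) (X : topologicalType) (d : X -> X -> R) :
    (forall x y, d x y = d y x) -> (forall x y z, d x z <= d x y + d y z) ->
    (forall (x : X) (A : set X),
      nbhs x A <-> exists2 e : R, 0 < e & [set y | d x y < e] `<=` A) ->
  forall c, continuous (d c : X -> R).
Proof.
move=> dC dtri dnb c x; apply/cvgrPdist_lt => e e0.
apply/dnb; exists e => // y /= dxy.
have := dtri c x y; have := dtri c y x; rewrite (dC y x) => h1 h2.
by rewrite ltr_distlC; apply/andP; split; lra.
Qed.

Lemma metrizable_bump (R : realType) (X : topologicalType) (x : X) (U : set X) :
  metrizable R X -> open U -> U x ->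
  exists g : X -> R, [/\ continuous g, forall z, 0 <= g z, 0 < g x &
    forall z, g z != 0 -> U z].
Proof.
move=> [d [d0 d_eq dC dtri dnb]] oU Ux.
have /dnb[e e0 eU] : nbhs x U by exact: open_nbhs_nbhs.
exists (fun z => Num.max 0 (e - d x z)); split.
- move=> z; apply: (@continuous_max _ _ (cst 0) (fun z => e - d x z)).
    exact: cvg_cst.
  by apply: cvgB; [exact: cvg_cst|exact: metric_continuous].
- by move=> z; rewrite le_max lexx.
- by rewrite d0 subr0 lt_max e0 orbT.
- move=> z h; apply: eU => /=; rewrite ltNge; apply: contra h => h.
  by rewrite max_l// subr_le0.
Qed.

(** * Countable separation of points, Urysohn functions and Borel sections *)

Lemma separating_closed_sets (R : realType) (X : ptopologicalType) :
  compact [set: X] -> metrizable R X ->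
  exists B : nat -> set X, (forall n, closed (B n)) /\
    forall x x', x <> x' -> exists n, B n x /\ ~ B n x'.
Proof.
move=> + [d [d0 d_eq dC dtri dnb]]; rewrite compact_cover => cX.
have cd := metric_continuous dC dtri dnb.
have net (n : nat) : exists D : {fset X}, forall x, exists2 c, c \in D &
    d c x < n.+1%:R^-1.
  have [| |D _ DX] := cX X setT (fun c => [set y | d c y < n.+1%:R^-1]).
  - move=> c _.
    by apply: (@open_comp _ _ (d c) [set r | r < n.+1%:R^-1]) => // y _; exact: cd.
  - by move=> x _; exists x => //=; rewrite d0 invr_gt0.
  - by exists D => x; have [c cD h] := DX x I; exists c.
have [D DP] := choice net.
(* Closed balls of radius [1/(n+1)] around the points of a finite net [D n]. Pairs are coded by
   naturals, and a code of no pair yields the whole space, which is closed too. *)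
pose b (p : nat * nat) := [set y | d (nth point (D p.1) p.2) y <= p.1.+1%:R^-1].
exists (fun k => if unpickle k is Some p then b p else setT); split.
  move=> k; case: (unpickle k) => [[n i]|]; last exact: closedT.
  exact: (@closed_comp _ _ (d _) [set r | r <= n.+1%:R^-1]).
move=> x x' xx'.
have dge0 u v : 0 <= d u v.
  by have := dtri u v u; rewrite d0 (dC v u); lra.
have dxx' : 0 < d x x'.
  by rewrite lt0r dge0 andbT; apply/eqP => /d_eq.
clear xx'.
(* With the radius below half of [d x x'], the ball whose centre is near [x] must miss [x']. *)
have [n nlt] : exists n, n.+1%:R^-1 < d x x' / 2.
  have h : 0 < d x x' / 2 by lra.
  exists (Num.truncn (d x x' / 2)^-1); rewrite invf_plt ?posrE//.
  exact: truncnS_gt.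
have [c cD cx] := DP n x.
exists (pickle (n, index c (D n))); rewrite pickleK /b /= nth_index//.
split.
  exact: ltW.
move: cx nlt; move: n.+1%:R^-1 => r cx nlt h.
by have := dtri x c x'; rewrite (dC x c); lra.
Qed.

(** Urysohn's lemma for [A] and the complement of [B], using that compact Hausdorff spaces are
    normal. *)
Lemma compact_separator (R : realType) (Y : topologicalType) (A B : set Y) :
  compact [set: Y] -> hausdorff_space Y -> closed A -> open B -> A `<=` B ->
  exists t : Y -> R, [/\ continuous t, forall y, 0 <= t y <= 1,
    forall y, A y -> t y = 1 & forall y, t y != 0 -> B y].
Proof.
move=> cY hY cA oB AB.
have /(@normal_separatorP R)/(_ (~` B) A) := compact_normal hY cY.
case/(_ (open_closedC oB) cA _).
  by apply/seteqP; split => // y [nB /AB].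
move=> /= uT [E h]; have /(@uniform_separatorP Y R) : uniform_separator (~` B) A.
  by exists uT, E.
move=> [t [ct rt t0 t1]]; exists t; split => //.
- by move=> y; have := rt (t y); apply; exists y.
- by move=> y Ay; apply: (t1 (t y)); exists y.
- by move=> y /eqP ty; apply: contrapT => nB; apply: ty; apply: (t0 (t y)); exists y.
Qed.

(* The closed sets [C n] successively cut down each fibre; they separate points,
   so a single point of the fibre remains. *)
Lemma borel_section (R : realType) (X Y : ptopologicalType) (pi : X -> Y)
    (K : set X) :
  compact [set: X] -> metrizable R X -> hausdorff_space Y -> continuous pi ->
  set_surj [set: X] [set: Y] pi -> closed K ->
  exists s : Y -> X, [/\ measurable_fun [set: borel Y] (s : borel Y -> borel X),
    forall y, pi (s y) = y & forall x, K x -> K (s (pi x))].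
Proof.
move=> cX mX hY cpi spi cK.
have [B [cB Bsep]] := separating_closed_sets cX mX.
(* [K] comes first, so that the cut made at stage 1 keeps the section inside [K] on every fibre that
   meets [K]. *)
pose C n := if n is m.+1 then B m else K.
have cC n : closed (C n) by case: n.
pose F := fix F n (y : Y) : set X := if n is m.+1 then
    if `[< F m y `&` C m !=set0 >] then F m y `&` C m else F m y
  else pi @^-1` [set y].
have FS n y : F n.+1 y =
    if `[< F n y `&` C n !=set0 >] then F n y `&` C n else F n y by [].
have cF n y : closed (F n y).
  elim: n => [|n IH].
    apply: (@closed_comp _ _ pi [set y]) => //.
    exact/accessible_closed_set1/hausdorff_accessible.
  by rewrite FS; case: ifP => // _; exact: closedI.
have F_neq0 n y : F n y !=set0.
  elim: n => [|n IH]; last by rewrite FS; case: asboolP.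
  by have [x _ <-] := spi y I; exists x.
have F_decr n y : F n.+1 y `<=` F n y.
  by rewrite FS; case: ifP => _ // x [].
have F_le n m y : (n <= m)%N -> F m y `<=` F n y.
  move=> /subnK <-; elim: (m - n)%N => [//|k IH].
  by rewrite addSn; apply: subset_trans IH; exact: F_decr.
(* Compactness: a decreasing sequence of nonempty closed sets has a common point. *)
have F_meet y (A : set X) : closed A -> (forall n, F n y `&` A !=set0) ->
    exists x, A x /\ forall n, F n y x.
  move=> cA FA.
  pose Phi := filter_from [set: nat] (fun n => F n y `&` A).
  have PhiF : ProperFilter Phi.
    apply: filter_from_proper; last by move=> n _; exact: FA.
    apply: filter_from_filter; first by exists 0%N.
    move=> i j _ _; exists (maxn i j) => // x [Fx Ax].
    by split; split => //; apply: F_le Fx; rewrite ?leq_maxl ?leq_maxr.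
  have [x [_ clx]] := cX Phi PhiF filterT.
  have Phix n : (F n y `&` A) x.
    have : closed (F n y `&` A) by exact: closedI.
    by apply => V nV; apply: clx nV; exists n.
  by exists x; split=> [|n]; [case: (Phix 0%N)|case: (Phix n)].
have F_uniq y x x' : (forall n, F n y x) -> (forall n, F n y x') -> x = x'.
  (* [B n] is [C n.+1], hence the cut by it happens at stage [n.+2]. Since [x] survives all stages
     and lies in [B n], that cut is not skipped and removes [x']. *)
  move=> Fx Fx'; apply: contrapT => /Bsep[n [Bx Bx']].
  have := Fx' n.+2; rewrite FS; case: asboolP => [_ []//|]; case.
  by exists x.
have F_pt y : exists x, forall n, F n y x.
  have [n|x [_ Fx]] := F_meet y setT closedT; first by rewrite setIT.
  by exists x.
have [s sP] := choice F_pt.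
(* Induction with [A] general: meeting [A] after a cut means meeting [C n] and [A] together before
   it, or [A] alone if the cut was skipped. At stage 0 the set is the image of a compact set, hence
   closed. *)
have F_meas n (A : set X) : closed A ->
    measurable ([set y | F n y `&` A !=set0] : set (borel Y)).
  elim: n A => [|n IH] A cA.
    rewrite [X in measurable X](_ : _ = pi @` A); last first.
      apply/seteqP; split=> [y [x [/= xy Ax]]|_ [x Ax <-]]; first by exists x.
      by exists x.
    have : closed (pi @` A).
      apply: compact_closed => //; apply: continuous_compact.
        exact: continuous_subspaceT.
      exact: subclosed_compact cA cX _.
    move=> /closed_openC oA.
    by rewrite -[X in measurable X]setCK; apply: measurableC; exact: sub_sigma_algebra.
  rewrite [X in measurable X](_ : _ =
     ([set y | F n y `&` C n !=set0] `&` [set y | F n y `&` (C n `&` A) !=set0])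
     `|` (~` [set y | F n y `&` C n !=set0] `&` [set y | F n y `&` A !=set0])).
    apply: measurableU; apply: measurableI; try apply: measurableC; apply: IH => //.
    exact: closedI.
  apply/seteqP; split => y.
    rewrite /mkset FS; case: asboolP => h FA; [left|right] => //.
    by split => //; rewrite setIA.
  rewrite /mkset FS; case: asboolP => h [[]|[]]//.
  by rewrite setIA.
have s_closed (A : set X) : closed A -> measurable (s @^-1` A : set (borel Y)).
  (* The fibre sets shrink to the single point [s y], so by compactness [s y] lies in [A] exactly
     when all of them meet [A]. *)
  move=> cA; rewrite [X in measurable X](_ : _ =
      \bigcap_n [set y | F n y `&` A !=set0]).
    by apply: bigcap_measurable => // n _; exact: F_meas.
  apply/seteqP; split=> [y Asy n _|y FA]; first by exists (s y); split.
  have [n|x [Ax Fx]] := F_meet y A cA; first exact: FA.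
  by rewrite /= (F_uniq y (s y) x).
exists s; split.
- apply: (@measurability _ _ (borel Y) (borel X) _ _ (@open X)) => // _ [U oU <-].
  rewrite setTI -[X in measurable X]setCK; apply: measurableC.
  by rewrite preimage_setC; apply: s_closed; exact: open_closedC.
- by move=> y; exact: (sP y 0%N).
- move=> x Kx; have := sP (pi x) 1%N; rewrite FS; case: asboolP => [_ []//|].
  by case; exists x.
Qed.

(** * Integrals of continuous functions and construction of elements of [borel_prob] *)

Lemma Rintegral_sum d (T : measurableType d) (R : realType)
    (mu : {measure set T -> \bar R}) (I : Type) (r : seq I) (P : pred I)
    (f : I -> T -> R) :
  (forall i, mu.-integrable [set: T] (EFin \o f i)) ->
  \int[mu]_x (\sum_(i <- r | P i) f i x) = \sum_(i <- r | P i) \int[mu]_x f i x.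
Proof.
move=> intf; rewrite /Rintegral.
under eq_integral do rewrite -sumEFin.
rewrite (integral_sum measurableT)// -sum_fine//= => i _.
by apply: integrable_fin_num => //; exact: intf.
Qed.

Section continuous_integrable.
Variables (R : realType) (X : ptopologicalType).
Hypothesis cX : compact [set: X].

Lemma continuous_borel_measurable (g : X -> R) :
  continuous g -> measurable_fun [set: borel X] (g : borel X -> R).
Proof.
move=> /continuousP cg; apply: (measurability _ (RGenOpens.measurableE R)).
move=> _ [_ [a [b ->] <-]]; rewrite setTI; apply: sub_sigma_algebra.
exact/cg/interval_open.
Qed.

Lemma compact_continuous_bounded (g : X -> R) :
  continuous g -> exists M : R, forall x, `|g x| <= M.
Proof.
move=> cg.
have /compact_bounded[M [_ MP]] : compact (g @` [set: X]).
  by apply: continuous_compact => //; exact: continuous_subspaceT.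
exists (M + 1) => x; apply: (MP (M + 1)); first by rewrite ltrDl.
by exists x.
Qed.

Lemma continuous_integrable (mu : probability (borel X) R) (g : X -> R) :
  continuous g -> mu.-integrable [set: borel X] (EFin \o g).
Proof.
move=> cg; apply: measurable_bounded_integrable => //.
- by rewrite (le_lt_trans (probability_le1 mu measurableT))// ltry.
- exact: continuous_borel_measurable.
- have [M gM] := compact_continuous_bounded cg.
  exists M; split; first exact: num_real.
  by move=> r Mr x _ /=; rewrite (le_trans (gM x))// ltW.
Qed.

End continuous_integrable.

Section borel_prob_of_probability.
Variables (R : realType) (X : ptopologicalType) (P : probability (borel X) R).

(** Normalises the values off the Borel sets as [bp_out] demands. *)
Definition bp_restr (B : set (borel X)) : \bar R :=
  if `[< measurable B >] then P B else 0%E.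

Let bp_restr0 : bp_restr set0 = 0%E.
Proof. by rewrite /bp_restr; case: ifP => //; rewrite measure0. Qed.

Let bp_restr_ge0 B : (0 <= bp_restr B)%E.
Proof. by rewrite /bp_restr; case: ifP. Qed.

Let bp_restrE B : measurable B -> bp_restr B = P B.
Proof. by move=> mB; rewrite /bp_restr asboolT. Qed.

Let bp_restr_sigma_additive : semi_sigma_additive bp_restr.
Proof.
move=> F mF tF mUF; rewrite bp_restrE//.
under eq_fun do under eq_bigr do rewrite bp_restrE//.
exact: measure_semi_sigma_additive.
Qed.

HB.instance Definition _ := isMeasure.Build _ _ _ bp_restr
  bp_restr0 bp_restr_ge0 bp_restr_sigma_additive.

Let bp_restr_setT : bp_restr [set: borel X] = 1%E.
Proof. by rewrite bp_restrE// probability_setT. Qed.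

HB.instance Definition _ :=
  Measure_isProbability.Build _ _ _ bp_restr bp_restr_setT.

Lemma borel_prob_of_probability : exists mu : borel_prob R X,
  forall B : set (borel X), measurable B -> mu B = P B.
Proof.
have out (B : set (borel X)) : ~ measurable B -> bp_restr B = 0%E.
  by move=> mB; rewrite /bp_restr asboolF.
by exists (BorelProb out) => B /bp_restrE.
Qed.

End borel_prob_of_probability.

Lemma Rintegral_induced (R : realType) (X Y : ptopologicalType) (pi : X -> Y)
    (cpi : continuous pi) (mu : borel_prob R X) (h : Y -> R) :
  compact [set: X] -> continuous h ->
  \int[induced_prob cpi mu]_(y in [set: borel Y]) h y =
  \int[mu]_(x in [set: borel X]) h (pi x).
Proof.
move=> cX ch.
pose pimf : {mfun borel X >-> borel Y} :=
  mfun_Sub (mem_set (continuous_borel cpi) : _ \in mfun).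
rewrite /Rintegral (eq_measure_integral (pushforward mu pimf)); last first.
  by move=> A mA _; exact: (induced_probE cpi mu mA).
rewrite (@integral_pushforward _ _ (borel X) (borel Y) R pi
  (continuous_borel cpi) mu setT (EFin \o h)) //.
- by apply/measurable_EFinP; exact: continuous_borel_measurable ch.
- rewrite preimage_setT; apply: (continuous_integrable cX mu (g := h \o pi)).
  by move=> x; apply: continuous_comp; [exact: cpi|exact: ch].
Qed.

(** * Mixtures of image measures *)

Section mixture.
Context d1 d2 (T1 : measurableType d1) (T2 : measurableType d2) (R : realType).
Variables (N : nat) (a : nat -> T1 -> R) (s : nat -> T1 -> T2).
Hypothesis ma : forall n, measurable_fun [set: T1] (a n).
Hypothesis ms : forall n, measurable_fun [set: T1] (s n).
Hypothesis a_ge0 : forall n y, 0 <= a n y.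
Hypothesis a_sum1 : forall y, \sum_(n < N) a n y = 1.

(** A Markov kernel: from [y], move to [s n y] with probability [a n y]. *)
Definition mixture (y : T1) : set T2 -> \bar R :=
  msum (fun n => mscale (NngNum (a_ge0 n y)) (\d_(s n y))) N.

HB.instance Definition _ y := Measure.on (mixture y).

Let mixtureE y B :
  mixture y B = (\sum_(n < N) (a n y)%:E * \d_(s n y) B)%E.
Proof. by []. Qed.

Let mixture_setT y : (mixture y [set: T2] <= 1)%E.
Proof.
rewrite mixtureE; under eq_bigr do rewrite diracT mule1.
by rewrite sumEFin a_sum1.
Qed.

(** The Giry space consists of subprobabilities, so a mass bound suffices here; total mass 1 is
    recovered after the bind by integrating the constant 1. *)
HB.instance Definition _ y :=
  Measure_isSubProbability.Build _ _ _ (mixture y) (mixture_setT y).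

Lemma integral_mixture y (h : T2 -> \bar R) :
  measurable_fun [set: T2] h -> (forall x, 0 <= h x)%E ->
  (\int[mixture y]_x h x = \sum_(n < N) (a n y)%:E * h (s n y))%E.
Proof.
move=> mh h0; rewrite ge0_integral_measure_sum//; apply: eq_bigr => n _.
by rewrite ge0_integral_mscale// integral_dirac// diracT mul1e.
Qed.

Let mixture_giry : T1 -> giry T2 R := mixture.

Let measurable_mixture : measurable_fun [set: T1] mixture_giry.
Proof.
apply: measurable_giry_codensity => // B mB.
under eq_fun do rewrite [_ B]mixtureE.
apply: emeasurable_sum => n; apply: emeasurable_funM.
  exact/measurable_EFinP/ma.
have mdB : measurable_fun [set: T2] (fun x => \d_x B : \bar R).
  exact: measurable_fun_dirac.
exact: measurableT_comp mdB (ms n).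
Qed.

Variable nu : probability T1 R.

(** The kernel averaged over [nu], which is the measure [\sum_n (s n)_* (a n nu)]. *)
Definition mixture_bind : set T2 -> \bar R :=
  giry_bind (nu : giry T1 R) measurable_mixture.

HB.instance Definition _ := SubProbability.on mixture_bind.

Lemma integral_mixture_bind (h : T2 -> \bar R) :
  measurable_fun [set: T2] h -> (forall x, 0 <= h x)%E ->
  (\int[mixture_bind]_x h x = \int[nu]_y \sum_(n < N) (a n y)%:E * h (s n y))%E.
Proof.
move=> mh h0; rewrite [LHS]giry_int_bind //; apply: eq_integral => y _.
exact: integral_mixture.
Qed.

Let mixture_bind_setT : mixture_bind [set: T2] = 1%E.
Proof.
have := integral_mixture_bind (h := cst 1%E) (@measurable_cst _ _ _ _ _ _) (fun=> lee01).
rewrite integral_cst// mul1e => ->.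
under eq_integral do (under eq_bigr do rewrite mule1; rewrite sumEFin a_sum1).
rewrite integral_cst// mul1e.
exact: probability_setT.
Qed.

HB.instance Definition _ := isProbability.Build _ _ _ mixture_bind mixture_bind_setT.

Lemma probability_mixture : exists P : probability T2 R,
  forall h : T2 -> \bar R, measurable_fun [set: T2] h -> (forall x, 0 <= h x)%E ->
  (\int[P]_x h x = \int[nu]_y \sum_(n < N) (a n y)%:E * h (s n y))%E.
Proof. by exists mixture_bind; exact: integral_mixture_bind. Qed.

End mixture.

(** * From the induced map to [pi]: testing on Dirac measures *)

Definition continuous_pack (X Y : topologicalType) (f : X -> Y)
    (cf : continuous f) : continuousType X Y :=
  HB.pack f (isContinuous.Build X Y f cf).

Lemma borel_prob_dirac (R : realType) (X : ptopologicalType) (x : X) :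
  exists mu : borel_prob R X,
    forall B : set (borel X), measurable B -> mu B = \d_(x : borel X) B.
Proof. exact: (borel_prob_of_probability (\d_(x : borel X) : probability (borel X) R)). Qed.

Lemma bp_integral_dirac (R : realType) (X : ptopologicalType) (x : X)
    (mu : borel_prob R X) (g : continuousType X R) :
  (forall B : set (borel X), measurable B -> mu B = \d_(x : borel X) B) ->
  bp_integral g mu = g x.
Proof.
move=> muE; rewrite /bp_integral /Rintegral.
rewrite (eq_measure_integral (\d_(x : borel X))) => [|B mB _]; last exact: muE.
rewrite integral_dirac ?diracT ?mul1e//.
by apply/measurable_EFinP; apply: continuous_borel_measurable; exact: cts_fun.
Qed.

Lemma open_map_of_induced_prob (R : realType) (X Y : ptopologicalType)
    (pi : X -> Y) (cpi : continuous pi) :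
  compact [set: X] -> metrizable R X -> hausdorff_space Y ->
  open_map (@induced_prob R X Y pi cpi) -> open_map pi.
Proof.
move=> cX mX hY opi U oU; rewrite openE => _ [x Ux <-]; rewrite /interior /=.
have [g [cg g0 gx gU]] := metrizable_bump mX oU Ux.
pose gc := continuous_pack cg.
have [mu muE] := borel_prob_dirac R x.
have [D DE] := choice (@borel_prob_dirac R Y).
have Dpix : induced_prob cpi mu = D (pi x).
  apply/borel_prob_eqP => B mB; rewrite induced_probE// DE// muE//.
  by rewrite -[X in measurable X]setTI; exact: continuous_borel.
(* Measures in this open set charge [U], because the bump [g] vanishes off [U]. *)
have oW : open [set mu' : borel_prob R X | 0 < bp_integral gc mu'].
  apply: (@open_comp _ _ (bp_integral gc) [set r | 0 < r]) => //.
  by move=> ? _; exact: bp_integral_continuous.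
have : nbhs (D (pi x)) (induced_prob cpi @` [set mu' | 0 < bp_integral gc mu']).
  apply: open_nbhs_nbhs; split; first exact: opi.
  by exists mu => //=; rewrite (bp_integral_dirac gc muE).
move=> /weakstar_nbhs[I [F [e [e0 FW]]]].
have : \forall y \near pi x, forall i, `|F i y - F i (pi x)| < e.
  apply: (@filter_forall _ _ (fun i y => `|F i y - F i (pi x)| < e)) => i.
  have /cvgrPdist_lt/(_ e e0) := @cts_fun _ _ (F i) (pi x).
  by apply: filterS => y; rewrite distrC.
apply: filterS => y Fy.
(* The Dirac mass at [y] is weak* close to the one at [pi x], hence has a preimage [mu'] charging
   [U]. *)
have [|mu' mu'_gt0 mu'E] := FW (D y).
  by move=> i; rewrite !(bp_integral_dirac _ (DE _)).
have my : measurable ([set y] : set (borel Y)).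
  rewrite -[X in measurable X]setCK; apply: measurableC; apply: sub_sigma_algebra.
  exact/closed_openC/accessible_closed_set1/hausdorff_accessible.
have mA : measurable (pi @^-1` [set y] : set (borel X)).
  by rewrite -[X in measurable X]setTI; exact: continuous_borel.
have mu'A : mu' (~` (pi @^-1` [set y])) = 0%E.
  rewrite probability_setC// -(induced_probE cpi)// mu'E DE// /dirac indicE.
  by rewrite mem_set// subee.
(* [mu'] is carried by the fibre of [y]. If that fibre missed [U], then [g] would vanish on it and
   have integral 0. *)
apply: contrapT => nU; move: mu'_gt0; rewrite /= /bp_integral /Rintegral.
rewrite (negligible_integral (measurableC mA) measurableT) //; last first.
  exact: (continuous_integrable cX).
rewrite setTD setCK integral0_eq ?ltxx// => z /= piz; congr EFin.
apply: contrapT => /eqP gz; apply: nU; exists z => //; exact: gU.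
Qed.

(** * Estimates for convex combinations and a partition of unity on [X] *)

(** Closeness is asked only at nonzero weights, since [phi n] and [a n] control the deviation only
    where they do not vanish. *)
Lemma convex_dist_le (R : realType) (N : nat) (p u v : 'I_N -> R) (e : R) :
  (forall n, 0 <= p n) -> \sum_n p n = 1 ->
  (forall n, p n != 0 -> `|u n - v n| <= e) ->
  `|\sum_n p n * u n - \sum_n p n * v n| <= e.
Proof.
move=> p0 p1 uv; rewrite -sumrB; apply: le_trans (ler_norm_sum _ _ _) _.
rewrite -[leRHS]mul1r -[X in X * _]p1 mulr_suml; apply: ler_sum => n _.
rewrite -mulrBr normrM ger0_norm//.
have [->|pn] := eqVneq (p n) 0; first by rewrite !mul0r.
by rewrite ler_wpM2l// uv.
Qed.

Lemma continuous_sum (R : realType) (T : topologicalType) (I : Type) (r : seq I)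
    (P : pred I) (f : I -> T -> R) :
  (forall i, continuous (f i)) -> continuous (fun x => \sum_(i <- r | P i) f i x).
Proof. by move=> cf; apply: continuous_big => [|i _]; [exact: add_continuous|exact: cf]. Qed.

Lemma continuous_prod (R : realType) (T : topologicalType) (I : Type) (r : seq I)
    (P : pred I) (f : I -> T -> R) :
  (forall i, continuous (f i)) -> continuous (fun x => \prod_(i <- r | P i) f i x).
Proof. by move=> cf; apply: continuous_big => [|i _]; [exact: mul_continuous|exact: cf]. Qed.

Lemma continuousMr (R : realType) (T : topologicalType) (f g : T -> R) :
  continuous f -> continuous g -> continuous (fun x => f x * g x).
Proof. by move=> cf cg x; apply: cvgM; [exact: cf|exact: cg]. Qed.

Lemma Rintegral_dist_le d (T : measurableType d) (R : realType)
    (P : probability T R) (f g : T -> R) (e : R) :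
  P.-integrable [set: T] (EFin \o f) -> P.-integrable [set: T] (EFin \o g) ->
  (forall x, `|f x - g x| <= e) -> `|\int[P]_x f x - \int[P]_x g x| <= e.
Proof.
move=> intf intg fge.
have intfg : P.-integrable [set: T] (EFin \o (fun x => f x - g x)).
  rewrite (_ : _ \o _ = (EFin \o f) \- (EFin \o g))%E; last first.
    by apply/funext => x /=; rewrite EFinB.
  exact: integrableB.
rewrite -RintegralB//; apply: le_trans (le_normr_Rintegral _ _) _ => //.
have -> : e = \int[P]_(x in setT) e.
  by rewrite Rintegral_cst// [X in fine X]probability_setT mulr1.
apply: le_Rintegral => //.
- exact: integrable_norm.
- exact: finite_measure_integrable_cst.
Qed.

(** The formula for [P] is given for nonnegative functions. Adding [M] makes [h] nonnegative and
    shifts both integrals by [M], the weights summing to 1. *)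
Lemma Rintegral_mixture d1 d2 (T1 : measurableType d1) (T2 : measurableType d2)
    (R : realType) (N : nat) (a : nat -> T1 -> R) (s : nat -> T1 -> T2)
    (P : probability T2 R) (nu : probability T1 R) (h : T2 -> R) (M : R) :
  (forall n, measurable_fun [set: T1] (a n)) ->
  (forall n, measurable_fun [set: T1] (s n)) ->
  (forall n y, 0 <= a n y) -> (forall y, \sum_(n < N) a n y = 1) ->
  (forall h : T2 -> \bar R, measurable_fun [set: T2] h -> (forall x, 0 <= h x)%E ->
    (\int[P]_x h x = \int[nu]_y \sum_(n < N) (a n y)%:E * h (s n y))%E) ->
  measurable_fun [set: T2] h -> (forall x, `|h x| <= M) ->
  nu.-integrable [set: T1] (EFin \o (fun y => \sum_(n < N) a n y * h (s n y))) /\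
  \int[P]_x h x = \int[nu]_y (\sum_(n < N) a n y * h (s n y)).
Proof.
move=> ma ms a0 a1 PE mh hM.
set k := fun y => \sum_(n < N) a n y * h (s n y).
have kM y : `|k y| <= M.
  rewrite -[leRHS]mul1r -(a1 y) mulr_suml; apply: le_trans (ler_norm_sum _ _ _) _.
  by apply: ler_sum => n _; rewrite normrM ger0_norm// ler_wpM2l.
have intb d (T : measurableType d) (Q : probability T R) (f : T -> R) :
    measurable_fun [set: T] f -> (forall x, `|f x| <= M) ->
    Q.-integrable [set: T] (EFin \o f).
  move=> mf fM; apply: measurable_bounded_integrable => //.
    by rewrite (le_lt_trans (probability_le1 Q measurableT))// ltry.
  exists M; split; first exact: num_real.
  by move=> r Mr x _ /=; rewrite (le_trans (fM x))// ltW.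
have intk : nu.-integrable [set: T1] (EFin \o k).
  apply: intb => //; apply: measurable_sum => n; apply: measurable_funM => //.
  exact: measurableT_comp.
split => //.
have inth : P.-integrable [set: T2] (EFin \o h) by exact: intb.
have intM d (T : measurableType d) (Q : probability T R) :
    Q.-integrable [set: T] (EFin \o cst M).
  exact: finite_measure_integrable_cst.
have addM d (T : measurableType d) (Q : probability T R) (f : T -> R) :
    Q.-integrable [set: T] (EFin \o f) ->
    \int[Q]_x (f x + M) = \int[Q]_x f x + M.
  move=> intf.
  have -> := RintegralD (f2 := cst M) measurableT intf (intM _ _ Q).
  by rewrite Rintegral_cst// [X in fine X]probability_setT mulr1.
apply: (addIr M); rewrite -!addM// /Rintegral; congr fine.
rewrite (PE (fun x => (h x + M)%:E)).
- apply: eq_integral => y _; under eq_bigr do rewrite -EFinM mulrDr.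
  by rewrite sumEFin big_split /= -mulr_suml a1 mul1r.
- by apply/measurable_EFinP; exact: measurable_funD.
- by move=> x; rewrite lee_fin; have := hM x; rewrite ler_norml; lra.
Qed.

(** Finitely many sets [{dev c < e}] cover [X]; the truncations of [e - dev (x n)] at 0 then have a
    positive sum, by which they are divided. Summing over [i] controls all test functions at
    once. *)
Lemma oscillation_partition (R : realType) (X : ptopologicalType) (I : finType)
    (F : I -> X -> R) (e : R) :
  compact [set: X] -> (forall i, continuous (F i)) -> 0 < e ->
  exists (N : nat) (x : nat -> X) (phi : nat -> X -> R),
    [/\ forall n, continuous (phi n), forall n z, 0 <= phi n z,
        forall z, \sum_(n < N) phi n z = 1 &
        forall n z, phi n z != 0 -> \sum_i `|F i z - F i (x n)| < e].
Proof.
move=> cX cF e0.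
pose dev c z := \sum_i `|F i z - F i c|.
have cdev c : continuous (dev c).
  apply: continuous_sum => i z; apply: cvg_norm; apply: cvgB; last exact: cvg_cst.
  exact: cF.
have dev0 c : dev c c = 0 by rewrite /dev big1// => i _; rewrite subrr normr0.
move: cX; rewrite compact_cover => cX.
have [| |D _ DX] := cX X setT (fun c => [set z | dev c z < e]).
- move=> c _.
  by apply: (@open_comp _ _ (dev c) [set r | r < e]) => // z _; exact: cdev.
- by move=> z _; exists z => //=; rewrite dev0.
pose x n := nth point (D : seq X) n.
pose p n z := Num.max 0 (e - dev (x n) z).
have p0 n z : 0 <= p n z by rewrite le_max lexx.
have cp n : continuous (p n).
  move=> z; apply: (@continuous_max _ _ (cst 0) (fun z => e - dev (x n) z)).
    exact: cvg_cst.
  by apply: cvgB; [exact: cvg_cst|exact: cdev].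
pose tot z := \sum_(n < size (D : seq X)) p n z.
have tot0 z : 0 < tot z.
  have [c cD cz] := DX z Logic.I.
  have ciD : (index c (D : seq X) < size (D : seq X))%N by rewrite index_mem.
  rewrite /tot (bigD1 (Ordinal ciD))//= ltr_wpDr ?sumr_ge0//.
  by rewrite lt_max /x nth_index// subr_gt0 (cz : dev c z < e) orbT.
have ctot : continuous tot by exact: continuous_sum.
exists (size (D : seq X)), x, (fun n z => p n z / tot z); split.
- move=> n; apply: continuousMr; first exact: cp.
  by move=> z; apply: cvgV; [rewrite gt_eqF|exact: ctot].
- by move=> n z; rewrite divr_ge0// ltW//.
- by move=> z; rewrite -mulr_suml -/(tot z) divff ?gt_eqF.
- move=> n z; rewrite ltNge; apply: contra => h.
  by rewrite /p max_l ?mul0r// subr_le0.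
Qed.

(** * Transfer of the partition of unity from [X] to [Y] *)

Section lift.
Variables (R : realType) (X Y : ptopologicalType) (pi : X -> Y).
Hypotheses (cX : compact [set: X]) (cY : compact [set: Y]).
Hypotheses (cpi : continuous pi) (spi : set_surj [set: X] [set: Y] pi).
Variables (mu : borel_prob R X) (N : nat) (phi : nat -> X -> R).
Hypothesis cphi : forall n, continuous (phi n).
Hypothesis phi_ge0 : forall n z, 0 <= phi n z.
Hypothesis phi_sum1 : forall z, \sum_(n < N) phi n z = 1.
Let nu := induced_prob cpi mu.

Let cintX (g : X -> R) : continuous g -> mu.-integrable [set: borel X] (EFin \o g).
Proof. exact: continuous_integrable. Qed.

Let cintY (g : Y -> R) : continuous g -> nu.-integrable [set: borel Y] (EFin \o g).
Proof. exact: continuous_integrable. Qed.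

Let cchi (chi : Y -> R) : continuous chi -> continuous (fun z => chi (pi z)).
Proof. by move=> c z; apply: continuous_comp; [exact: cpi|exact: c]. Qed.

(* When [chi] is [nu]-null the integrals give no information, and the weights are
   those of the Dirac measure at a point lying over the support of [chi]. *)
Lemma lift_weights (chi : Y -> R) :
  continuous chi -> (forall y, 0 <= chi y) ->
  exists w : nat -> R, [/\ forall n, 0 <= w n, \sum_(n < N) w n = 1,
    forall n, (n < N)%N -> w n * \int[nu]_(y in [set: borel Y]) chi y =
      \int[mu]_(z in [set: borel X]) (phi n z * chi (pi z)) &
    forall n y, w n != 0 -> chi y != 0 ->
      exists2 z, phi n z != 0 & chi (pi z) != 0].
Proof.
move=> ch chi0.
have cpc n : continuous (fun z => phi n z * chi (pi z)).
  by apply: continuousMr => //; exact: cchi.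
have nuE : \int[nu]_(y in [set: borel Y]) chi y =
    \int[mu]_(z in [set: borel X]) chi (pi z) by exact: Rintegral_induced.
have [c0|c0] := eqVneq (\int[nu]_(y in [set: borel Y]) chi y) 0; last first.
  exists (fun n => \int[mu]_(z in [set: borel X]) (phi n z * chi (pi z)) /
    \int[nu]_(y in [set: borel Y]) chi y); split.
  - move=> n; rewrite divr_ge0// Rintegral_ge0// => z _; exact: mulr_ge0.
  - rewrite -mulr_suml -Rintegral_sum//; last first.
      by move=> i; apply: cintX; exact: cpc.
    under eq_Rintegral do rewrite -mulr_suml phi_sum1 mul1r.
    by rewrite -nuE divff.
  - by move=> n _; rewrite divfK.
  - move=> n y wn _; apply: contrapT => nex; move: wn => /eqP; apply.
    rewrite [X in X / _](_ : _ = 0) ?mul0r// /Rintegral integral0_eq// => z _.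
    congr EFin; apply: contrapT => /eqP; rewrite mulf_eq0 negb_or => /andP[? ?].
    by apply: nex; exists z.
(* If [chi] vanishes identically, any point will do: the support condition on the weights is then
   vacuous. *)
have [x xP] : exists x, forall y, chi y != 0 -> chi (pi x) != 0.
  have [[y cy]|nex] := pselect (exists y, chi y != 0).
    by have [x _ xy] := spi (Logic.I : [set: Y] y); exists x => _ _; rewrite xy.
  by exists point => y cy; exfalso; apply: nex; exists y.
exists (phi ^~ x); split => //.
(* [phi n] is at most 1, so the integral lies between 0 and that of [chi], which is 0. *)
- move=> n nN; rewrite c0 mulr0; apply/esym/eqP; rewrite eq_le; apply/andP; split.
    rewrite -c0 nuE; apply: le_Rintegral => //.
    + by apply: cintX; exact: cpc.
    + by apply: cintX; exact: cchi.
    + move=> z _; rewrite -[leRHS]mul1r ler_wpM2r//.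
      by rewrite -(phi_sum1 z) (bigD1 (Ordinal nN))//= lerDl sumr_ge0.
  by apply: Rintegral_ge0 => z _; exact: mulr_ge0.
- by move=> n y wn cy; exists x => //; exact: xP cy.
Qed.

Lemma lift_partition (t : nat -> Y -> R) :
  (forall n, continuous (t n)) -> (forall n y, 0 <= t n y <= 1) ->
  (forall n z, phi n z != 0 -> t n (pi z) = 1) ->
  exists a : nat -> Y -> R,
    [/\ forall n, continuous (a n), forall n y, 0 <= a n y,
        forall y, \sum_(n < N) a n y = 1,
        forall n y, (n < N)%N -> a n y != 0 -> t n y != 0 &
        forall n, (n < N)%N -> \int[nu]_(y in [set: borel Y]) a n y =
          \int[mu]_(z in [set: borel X]) phi n z].
Proof.
move=> ct t01 tphi.
pose chi (S : {set 'I_N}) y :=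
  \prod_(n < N) (if n \in S then t n y else 1 - t n y).
have cch S : continuous (chi S).
  apply: continuous_prod => n; case: (n \in S); first exact: ct.
  by move=> y; apply: cvgB; [exact: cvg_cst|exact: ct].
have chi0 S y : 0 <= chi S y.
  apply: prodr_ge0 => n _; have /andP[h0 h1] := t01 n y.
  by case: ifP => // _; rewrite subr_ge0.
have chi1 y : \sum_S chi S y = 1.
  (* Expanding the product of the factors [t n y + (1 - t n y)], all equal to 1, gives the sum of
     all [chi S y]. *)
  rewrite /chi; have := bigA_distr 1 +%R (fun n : 'I_N => t n y) (fun n => 1 - t n y).
  move=> <-; rewrite big1// => n _; exact: subrKC.
have chi_in S (n : 'I_N) y : chi S y != 0 -> (if n \in S then t n y else 1 - t n y) != 0.
  by move=> /prodf_neq0; exact.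
have [w wP] := choice (fun S => lift_weights (cch S) (chi0 S)).
exists (fun n y => \sum_S w S n * chi S y); split.
- move=> n; apply: continuous_sum => S; apply: continuousMr; last exact: cch.
  by move=> y; exact: cvg_cst.
- by move=> n y; apply: sumr_ge0 => S _; have [w0 _ _ _] := wP S; exact: mulr_ge0.
- move=> y; rewrite exchange_big /= -[RHS](chi1 y); apply: eq_bigr => S _.
  by have [_ w1 _ _] := wP S; rewrite -mulr_suml w1 mul1r.
(* A nonzero term with [t n y = 0] would force [n] out of [S]. Its weight gives a [z] with [phi n z]
   and [chi S (pi z)] nonzero, but [t n (pi z) = 1] kills the factor [1 - t n] of [chi S] there. *)
- move=> n y nN; apply: contra_neq => tn0; apply: big1 => S _.
  apply/eqP; apply: contrapT => /negP; rewrite mulf_eq0 negb_or => /andP[wn cy].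
  have [_ _ _ /(_ _ _ wn cy)[z pz cz]] := wP S.
  have := chi_in S (Ordinal nN) _ cz; have := chi_in S (Ordinal nN) _ cy.
  by case: ifP => _ /=; rewrite ?tn0 ?eqxx// tphi// subrr eqxx.
- move=> n nN; rewrite Rintegral_sum; last first.
    move=> S; apply: cintY; apply: continuousMr; last exact: cch.
    by move=> y; exact: cvg_cst.
  under eq_bigr => S _.
    rewrite RintegralZl//; last exact: cintY.
    have [_ _ /(_ n nN) -> _] := wP S; over.
  rewrite -Rintegral_sum; last first.
    by move=> S; apply: cintX; apply: continuousMr => //; exact: cchi.
  by apply: eq_Rintegral => z _; rewrite -mulr_sumr chi1 mulr1.
Qed.

End lift.

(** * From [pi] to the induced map: lifting nearby measures *)

Lemma induced_prob_open (R : realType) (X Y : ptopologicalType)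
    (pi : X -> Y) (cpi : continuous pi) :
  compact [set: X] -> metrizable R X -> compact [set: Y] -> hausdorff_space Y ->
  set_surj [set: X] [set: Y] pi ->
  open_map pi -> open_map (@induced_prob R X Y pi cpi).
Proof.
move=> cX mX cY hY spi opi W oW; rewrite openE => _ [mu Wmu <-].
rewrite /interior /=; set nu := induced_prob cpi mu.
have /weakstar_nbhs[I [F [e [e0 FW]]]] : nbhs mu W by exact: open_nbhs_nbhs.
have cF i : continuous (F i) by exact: cts_fun.
(* Three errors of size [e / 3] will be added. The partition uses the finer scale [e / 6], so that
   the closed set [{dev n <= e / 6}] sits inside the open set [{dev n < e / 3}] and a cut-off [t n]
   fits between their images. *)
have e30 : 0 < e / 3 by lra.
have e60 : 0 < e / 6 by lra.
have e63 : e / 6 <= e / 3 by lra.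
have [N [x [phi [cphi phi0 phi1 phiF]]]] := oscillation_partition cX cF e60.
pose dev n z : R := \sum_i `|F i z - F i (x n)|.
have F_dev n z i : `|F i z - F i (x n)| <= dev n z.
  by rewrite /dev (bigD1 i)//= lerDl sumr_ge0.
have cdev n : continuous (dev n).
  apply: continuous_sum => i z; apply: cvg_norm; apply: cvgB; last exact: cvg_cst.
  exact: cF.
have closed_dev n r : closed [set z | dev n z <= r].
  exact: (@closed_comp _ _ (dev n) [set u | u <= r]).
have sep n : exists t : Y -> R, [/\ continuous t, forall y, 0 <= t y <= 1,
    forall y, (pi @` [set z | dev n z <= e / 6]) y -> t y = 1 &
    forall y, t y != 0 -> (pi @` [set z | dev n z < e / 3]) y].
  apply: compact_separator => //.
  - apply: compact_closed => //; apply: continuous_compact.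
      exact: continuous_subspaceT.
    exact: subclosed_compact (closed_dev n _) cX _.
  - by apply/opi/(@open_comp _ _ (dev n) [set r | r < e / 3]) => // z _; exact: cdev.
  - by move=> _ [z /= dz <-]; exists z => //=; lra.
have [t tP] := choice sep.
have [|||a [ca a0 a1 at0 aphi]] :=
  lift_partition cX cY cpi spi mu cphi phi0 phi1 (t := t).
- by move=> n; case: (tP n).
- by move=> n; case: (tP n).
- move=> n z /phiF dz; have [_ _ h _] := tP n; apply: h; exists z => //=.
  exact: ltW.
have [s sP] := choice (fun n =>
  borel_section cX mX hY cpi spi (closed_dev n (e / 3))).
have s_dev n y : (n < N)%N -> a n y != 0 -> dev n (s n y) <= e / 3.
  move=> nN /(at0 _ _ nN) ty; have [_ _ _ /(_ _ ty)[z /= dz <-]] := tP n.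
  by have [_ _] := sP n; apply; exact: ltW.
pose A i y := \sum_(n < N) a n y * F i (x n).
have cA i : continuous (A i).
  by apply: continuous_sum => n; apply: continuousMr => // y; exact: cvg_cst.
pose Ac i := continuous_pack (cA i).
have muA i : `|bp_integral (F i) mu - bp_integral (Ac i) nu| <= e / 3.
  (* Replacing each [a n] by [phi n] is allowed because their integrals against [nu] and [mu]
     agree. *)
  have -> : bp_integral (Ac i) nu = \int[mu]_(z in [set: borel X])
      (\sum_(n < N) phi n z * F i (x n)).
    rewrite /bp_integral /= /A !Rintegral_sum; last 2 first.
    - move=> n; apply: continuous_integrable => //.
      by apply: continuousMr => // z; exact: cvg_cst.
    - move=> n; apply: continuous_integrable => //.
      by apply: continuousMr => // z; exact: cvg_cst.
    apply: eq_bigr => n _; rewrite !RintegralZr// ?aphi//; exact: continuous_integrable.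
  apply: Rintegral_dist_le.
  - exact: continuous_integrable.
  - apply: continuous_integrable => //; apply: continuous_sum => n.
    by apply: continuousMr => // z; exact: cvg_cst.
  move=> z; rewrite (_ : F i z = \sum_(n < N) phi n z * F i z); last first.
    by rewrite -mulr_suml phi1 mul1r.
  apply: convex_dist_le => // n /phiF dz.
  exact: le_trans (F_dev n z i) (le_trans (ltW dz) e63).
have : \forall nu' \near nu, forall i,
    `|bp_integral (Ac i) nu' - bp_integral (Ac i) nu| < e / 3.
  apply: (@filter_forall _ _ (fun i (nu' : borel_prob R Y) =>
    `|bp_integral (Ac i) nu' - bp_integral (Ac i) nu| < e / 3)
    (nbhs nu) (nbhs_filter nu)) => i.
  have /cvgrPdist_lt/(_ _ e30) := @bp_integral_continuous R Y (Ac i) nu.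
  by apply: filterS => nu'; rewrite distrC.
apply: filterS => nu' nu'A.
have ma n : measurable_fun [set: borel Y] (a n : borel Y -> R).
  exact: continuous_borel_measurable.
have ms n : measurable_fun [set: borel Y] (s n : borel Y -> borel X).
  by have [] := sP n.
have [P PE] := probability_mixture (T1 := borel Y) (T2 := borel X) ma ms a0 a1 nu'.
have [mu' mu'E] := borel_prob_of_probability P.
exists mu'; last first.
  apply/borel_prob_eqP => B mB.
  have mpB : measurable (pi @^-1` B : set (borel X)).
    by rewrite -[X in measurable X]setTI; exact: continuous_borel.
  rewrite induced_probE// mu'E//.
  rewrite -[pi @^-1` B]setIT -[LHS]integral_indic// PE; last 2 first.
  - by apply/measurable_EFinP; exact: measurable_indic.
  - by move=> z; rewrite lee_fin.
  transitivity (\int[nu']_(y in [set: borel Y]) (\1_B y)%:E)%E; last first.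
    by rewrite integral_indic// setIT.
  apply: eq_integral => y _; under eq_bigr => n _.
    rewrite -EFinM (_ : \1_(pi @^-1` B) (s n y) = \1_B y); last first.
      by have [_ spy _] := sP n; rewrite !indicE; congr (_ _)%:R;
         apply/idP/idP; rewrite !inE /= spy.
    over.
  by rewrite sumEFin -mulr_suml a1 mul1r.
apply: FW => i.
have [M FM] := compact_continuous_bounded cX (cF i).
have [intk PF] := Rintegral_mixture (T1 := borel Y) (T2 := borel X)
  ma ms a0 a1 PE (continuous_borel_measurable (cF i)) FM.
have mu'A : `|bp_integral (F i) mu' - bp_integral (Ac i) nu'| <= e / 3.
  have -> : bp_integral (F i) mu' = \int[P]_(z in [set: borel X]) F i z.
    rewrite /bp_integral /Rintegral (eq_measure_integral P)// => B mB _.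
    exact: mu'E.
  rewrite PF; apply: Rintegral_dist_le  => //.
    exact: (continuous_integrable cY nu' (cA i)).
  move=> y; apply: convex_dist_le => // n any.
  by apply: le_trans (F_dev n _ i) _; exact: s_dev.
(* The outer two differences are at most [e / 3]; the middle one, by the choice of [nu'], is
   strictly smaller, which makes the total less than [e]. *)
rewrite (_ : _ - _ = (bp_integral (F i) mu' - bp_integral (Ac i) nu') +
  (bp_integral (Ac i) nu' - bp_integral (Ac i) nu) -
  (bp_integral (F i) mu - bp_integral (Ac i) nu)); last by ring.
apply: le_lt_trans (ler_normB _ _) _.
apply: le_lt_trans (lerD (ler_normD _ _) (lexx _)) _.
by move: mu'A (nu'A i) (muA i); lra.
Qed.

Theorem theorem1p2 (R : realType) (X Y : ptopologicalType)
    (cptX : compact [set: X]) (metX : metrizable R X)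
    (cptY : compact [set: Y]) (metY : metrizable R Y)
    (pi : X -> Y) (cpi : continuous pi) (spi : set_surj [set: X] [set: Y] pi) :
  open_map pi <-> open_map (@induced_prob R X Y pi cpi).
Proof.
have hY := metrizable_hausdorff metY.
split; first exact: induced_prob_open.
exact: open_map_of_induced_prob.
Qed.
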